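(* Let $L$ be a finite-dimensional Lie algebra over a field of characteristic $0$ and let $J$ be a Lie-orthogonal operator on $L$. Then $J(R)\subseteq R$, where $R=R(L)$ is the radical of $L$, i.e., its maximal solvable ideal.
   Context: A linear operator $J$ on a Lie algebra $L$ is called Lie-orthogonal if $[Jx,Jy]=[x,y]$ for all $x,y\in L$. *)

(* Defs.v *)
From HB Require Import structures.
From mathcomp Require Import all_boot all_order all_algebra.
From Stdlib Require Import Classical ClassicalEpsilon.
Set Implicit Arguments. Unset Strict Implicit. Unset Printing Implicit Defensive.
Import GRing.Theory.
Local Open Scope ring_scope.

(* Finite dimensionality is part of the [vectType] structure; dimension 0 is
   allowed.  Bilinearity is stated as linearity in each argument. *)
HB.mixin Record Vector_isLieAlgebra (K : fieldType) L of Vector K L := {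
  bracket : L -> L -> L;
  bracket_linearl : forall y : L, linear (bracket^~ y);
  bracket_linearr : forall x : L, linear (bracket x);
  bracketxx : forall x : L, bracket x x = 0;
  bracket_jacobi : forall x y z : L,
    bracket x (bracket y z) + bracket y (bracket z x)
      + bracket z (bracket x y) = 0
}.

#[short(type="lieAlgType")]
HB.structure Definition LieAlgebra (K : fieldType) :=
  { L of Vector_isLieAlgebra K L & Vector K L }.

Notation "[ 'lie' x , y ]" := (bracket x y)
  (at level 0, x at level 99, y at level 99,
   format "[ 'lie'  x ,  y ]") : ring_scope.

Definition lie_orthogonal (K : fieldType) (L : lieAlgType K) (J : 'End(L)) :=
  forall x y : L, [lie J x, J y] = [lie x, y].

Definition lie_ideal (K : fieldType) (L : lieAlgType K) (I : {vspace L}) :=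
  forall x y : L, y \in I -> [lie x, y] \in I.

(* The span of all [lie u, v] with u in U and v in V; by bilinearity basis
   vectors suffice (see [bracketvP]). *)
Definition bracketv (K : fieldType) (L : lieAlgType K) (U V : {vspace L}) :
    {vspace L} :=
  <<[seq [lie u, v] | u <- vbasis U, v <- vbasis V]>>%VS.

Definition lie_derived (K : fieldType) (L : lieAlgType K) (n : nat)
    (U : {vspace L}) : {vspace L} :=
  iter n (fun V => bracketv V V) U.

Definition lie_solvable (K : fieldType) (L : lieAlgType K) (U : {vspace L}) :=
  exists n, lie_derived n U = 0%VS.

Definition maximal_solvable_ideal (K : fieldType) (L : lieAlgType K)
    (R : {vspace L}) :=
  [/\ lie_ideal R, lie_solvable R &
      forall I : {vspace L},
        lie_ideal I -> lie_solvable I -> (R <= I)%VS -> I = R].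

(* The maximal solvable ideal exists and is unique, see [radicalP] and
   [radical_unique]; it is the greatest one, see [radical_max]. *)
Definition radical (K : fieldType) (L : lieAlgType K) : {vspace L} :=
  epsilon (inhabits 0%VS) (@maximal_solvable_ideal K L).

Section Theory.
Variables (K : fieldType) (L : lieAlgType K).
Implicit Types (x y z : L) (U V W I J : {vspace L}).

Lemma bracketDl x y z : [lie x + y, z] = [lie x, z] + [lie y, z].
Proof. by have := bracket_linearl z 1 x y; rewrite !scale1r. Qed.

Lemma bracketDr x y z : [lie z, x + y] = [lie z, x] + [lie z, y].
Proof. by have := bracket_linearr z 1 x y; rewrite !scale1r. Qed.

Lemma bracket0l z : [lie 0, z] = 0.
Proof. by apply: (@addrI _ [lie 0, z]); rewrite -bracketDl !addr0. Qed.

Lemma bracket0r z : [lie z, 0] = 0.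
Proof. by apply: (@addrI _ [lie z, 0]); rewrite -bracketDr !addr0. Qed.

Lemma bracketZl a x z : [lie a *: x, z] = a *: [lie x, z].
Proof. by have := bracket_linearl z a x 0; rewrite /= bracket0l !addr0. Qed.

Lemma bracketZr a x z : [lie z, a *: x] = a *: [lie z, x].
Proof. by have := bracket_linearr z a x 0; rewrite /= bracket0r !addr0. Qed.

Lemma bracketC x y : [lie x, y] = - [lie y, x].
Proof.
apply/eqP; rewrite -addr_eq0; apply/eqP.
have := bracketxx (x + y).
by rewrite bracketDl !bracketDr !bracketxx add0r addr0.
Qed.

Lemma bracket_suml (n : nat) (F : 'I_n -> L) z :
  [lie \sum_i F i, z] = \sum_i [lie F i, z].
Proof.
exact: (big_morph (fun x => [lie x, z])
  (fun x y => bracketDl x y z) (bracket0l z)).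
Qed.

Lemma bracket_sumr (n : nat) (F : 'I_n -> L) z :
  [lie z, \sum_i F i] = \sum_i [lie z, F i].
Proof.
exact: (big_morph (fun x => [lie z, x])
  (fun x y => bracketDr x y z) (bracket0r z)).
Qed.

Lemma mem_bracketv U V x y :
  x \in U -> y \in V -> [lie x, y] \in bracketv U V.
Proof.
move=> /coord_vbasis -> /coord_vbasis ->; rewrite bracket_suml.
apply: memv_suml => i _; rewrite bracket_sumr; apply: memv_suml => j _.
rewrite bracketZl bracketZr !memvZ //; apply: memv_span.
by apply: allpairs_f; apply: mem_nth; rewrite size_tuple.
Qed.

Lemma bracketvP U V W :
  (forall x y, x \in U -> y \in V -> [lie x, y] \in W) <-> (bracketv U V <= W)%VS.
Proof.
split=> [h|h x y xU yV]; last exact: (subvP h) (mem_bracketv xU yV).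
by apply/span_subvP => _ /allpairsP[[u v] /= [uU vV ->]]; apply: h;
  apply: vbasis_mem.
Qed.

Lemma lie_derivedS U V n :
  (U <= V)%VS -> (lie_derived n U <= lie_derived n V)%VS.
Proof.
move=> UV; elim: n => //= n /subvP IH; apply/bracketvP => x y xU yU.
by apply: mem_bracketv; apply: IH.
Qed.

Lemma lie_ideal0 : lie_ideal (0%VS : {vspace L}).
Proof. by move=> x y; rewrite memv0 => /eqP ->; rewrite bracket0r mem0v. Qed.

Lemma lie_ideal_add I J : lie_ideal I -> lie_ideal J -> lie_ideal (I + J)%VS.
Proof.
move=> hI hJ x _ /memv_addP[u uI [v vJ ->]].
by rewrite bracketDr memv_add ?hI ?hJ.
Qed.

Lemma lie_derived_add I J n :
  lie_ideal J -> (lie_derived n (I + J) <= lie_derived n I + J)%VS.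
Proof.
move=> hJ; elim: n => //= n /subvP IH; apply/bracketvP => x y.
move=> /IH/memv_addP[a aD [b bJ ->]] /IH/memv_addP[c cD [d dJ ->]].
rewrite bracketDl bracketDr -addrA memv_add ?mem_bracketv // memvD //.
  exact: hJ.
by rewrite bracketC memvN hJ.
Qed.

Lemma lie_solvable_add I J : lie_ideal J ->
  lie_solvable I -> lie_solvable J -> lie_solvable (I + J)%VS.
Proof.
move=> hJ [n hn] [m hm]; exists (m + n)%N; apply/eqP; rewrite -subv0 -hm.
rewrite /lie_derived iterD; apply: lie_derivedS.
by apply: subv_trans (lie_derived_add I n hJ) _; rewrite hn add0v.
Qed.

Lemma radical_exists : exists R : {vspace L}, maximal_solvable_ideal R.
Proof.
suff H k I : (\dim (fullv : {vspace L}) - \dim I < k)%N ->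
    lie_ideal I -> lie_solvable I -> exists R : {vspace L}, maximal_solvable_ideal R.
  by apply: (H _ _ (ltnSn _) lie_ideal0); exists 0%N.
elim: k I => // k IH I hk idI solI.
have [hmax|] := classic (maximal_solvable_ideal I); first by exists I.
move=> hn; apply: NNPP => hno; apply: hn; split=> // J idJ solJ IJ.
apply: NNPP => neq; apply: hno; apply: (IH J) => //.
have ltd : (\dim I < \dim J)%N.
  rewrite ltn_neqAle dimvS // andbT; apply/negP => /eqP e.
  by apply: neq; apply/esym/eqP; rewrite eqEdim IJ e leqnn.
have := dimvS (subvf J); have := dimvS (subvf I); move: hk ltd.
rewrite !ltnS => hk ltd _ hJ; apply: leq_trans hk.
exact: ltn_sub2l (leq_trans ltd hJ) ltd.
Qed.

Lemma radicalP : maximal_solvable_ideal (radical L).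
Proof. exact: epsilon_spec radical_exists. Qed.

Lemma maximal_solvable_ideal_max R I : maximal_solvable_ideal R ->
  lie_ideal I -> lie_solvable I -> (I <= R)%VS.
Proof.
move=> [idR solR maxR] idI solI.
rewrite -(maxR (R + I)%VS) ?addvSl ?addvSr //; first exact: lie_ideal_add.
exact: lie_solvable_add.
Qed.

Lemma radical_max I : lie_ideal I -> lie_solvable I -> (I <= radical L)%VS.
Proof. exact: maximal_solvable_ideal_max radicalP. Qed.

Lemma radical_unique R : maximal_solvable_ideal R -> R = radical L.
Proof.
move=> hR; have [idR solR _] := hR; have [idr solr _] := radicalP.
by apply/eqP; rewrite eqEsubv radical_max ?(maximal_solvable_ideal_max hR).
Qed.

End Theory.

(* Main.v *)
(** Let [R] be the radical and [C] the ideal of all [c] with [[c, [L, L]] <= R].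
    The derived algebra of [C] lies in [C] and in [[L, L]], so its second derived
    algebra lies in [R]; hence [C] is solvable and [C <= R].  For [x] in [R], the
    Jacobi identity expresses [[J x, [y, z]] = [J x, [J y, J z]]] by brackets with
    [[J x, J y] = [x, y]] and [[J x, J z] = [x, z]], which lie in [R]; so [J x] is
    in [C]. *)

Require Import Defs.
From HB Require Import structures.
From mathcomp Require Import all_boot all_order all_algebra.
Set Implicit Arguments. Unset Strict Implicit. Unset Printing Implicit Defensive.
Import GRing.Theory.
Local Open Scope ring_scope.

Section LieCentralizer.
Variables (K : fieldType) (L : lieAlgType K).
Implicit Types (x y z : L) (U V W I : {vspace L}).

(** This lets [linfun (bracket x)] stand for ad x, so that preimages of subspaces under ad x are
    subspaces. *)
HB.instance Definition _ x :=
  GRing.isLinear.Build K L L *:%R (bracket x) (bracket_linearr x).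

Lemma bracket_derivation x y z :
  [lie x, [lie y, z]] = [lie [lie x, y], z] + [lie y, [lie x, z]].
Proof.
have /eqP := bracket_jacobi x y z.
rewrite -addrA addr_eq0 => /eqP ->.
by rewrite opprD addrC (bracketC z x) (bracketC [lie x, y])
  -[- [lie x, z]]scaleN1r bracketZr scaleN1r opprK.
Qed.

Lemma lie_ideall I x y : lie_ideal I -> x \in I -> [lie x, y] \in I.
Proof. by move=> idI xI; rewrite bracketC memvN idI. Qed.

Lemma lie_ideal_bracketv U V :
  lie_ideal U -> lie_ideal V -> lie_ideal (bracketv U V).
Proof.
(* The preimage of [bracketv U V] under ad x is a subspace, so only the generating brackets need a
   check. *)
move=> idU idV x y yUV; rewrite -[[lie x, y]](lfunE (bracket x)) memv_preim.
apply: (subvP _ _ yUV); apply/bracketvP => {yUV} {}y z yU zV.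
by rewrite -memv_preim lfunE /= bracket_derivation memvD // mem_bracketv ?idU ?idV.
Qed.

(** Finitely many preimages under ad of basis vectors make this a [{vspace L}]; the swapped order of
    the bracket costs only a sign. *)
Definition lie_centralizer_mod U W : {vspace L} :=
  (\bigcap_(i < \dim U) linfun (bracket (vbasis U)`_i) @^-1: W)%VS.

Lemma lie_centralizer_modP U W x :
  reflect (forall u, u \in U -> [lie x, u] \in W)
          (x \in lie_centralizer_mod U W).
Proof.
rewrite memvE; apply: (iffP subv_bigcapP) => [cx u uU | cx i _].
  rewrite (coord_vbasis uU) bracket_sumr; apply: memv_suml => i _; rewrite bracketZr memvZ //.
  by have := cx i isT; rewrite -memvE -memv_preim lfunE /= bracketC memvN.
rewrite -memvE -memv_preim lfunE /= bracketC memvN cx // vbasis_mem // mem_nth //.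
by rewrite size_tuple.
Qed.

Lemma lie_ideal_centralizer_mod U W :
  lie_ideal U -> lie_ideal W -> lie_ideal (lie_centralizer_mod U W).
Proof.
move=> idU idW x y /lie_centralizer_modP cy; apply/lie_centralizer_modP => u uU.
(* Here [[[x, y], u] = [x, [y, u]] - [y, [x, u]]]: the first term uses that [W] is an ideal, the
   second that [U] is. *)
have /eqP := bracket_derivation x y u; rewrite -subr_eq => /eqP <-.
by rewrite memvB // ?(cy _ (idU _ _ uU)) // idW ?cy.
Qed.

Lemma lie_solvable_derived n U : lie_solvable (lie_derived n U) -> lie_solvable U.
Proof. by case=> m Um0; exists (m + n)%N; rewrite /lie_derived iterD. Qed.

Lemma lie_solvableS U V : (U <= V)%VS -> lie_solvable V -> lie_solvable U.
Proof.
move=> sUV [n Vn0]; exists n; apply/eqP.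
by rewrite -subv0 -Vn0 lie_derivedS.
Qed.

Lemma lie_centralizer_mod_derived_radical :
  (lie_centralizer_mod (bracketv fullv fullv) (radical L) <= radical L)%VS.
Proof.
set C := lie_centralizer_mod _ _; have [idR solR _] := radicalP L.
have idL : lie_ideal (fullv : {vspace L}) by move=> *; apply: memvf.
have idC : lie_ideal C.
  by apply: lie_ideal_centralizer_mod => //; apply: lie_ideal_bracketv.
apply: radical_max => //; apply: (@lie_solvable_derived 2).
apply: lie_solvableS solR; apply/bracketvP => x y /= xC' yC'.
have /subvP sC'C : (bracketv C C <= C)%VS by apply/bracketvP => *; apply: idC.
have /subvP sC'L' : (bracketv C C <= bracketv fullv fullv)%VS.
  by apply/bracketvP => *; apply: mem_bracketv; apply: memvf.
by have /lie_centralizer_modP := sC'C _ xC'; apply; apply: sC'L'.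
Qed.

End LieCentralizer.

Theorem lemma5 (K : fieldType) (charK0 : [pchar K] =i pred0)
  (L : lieAlgType K) (J : 'End(L)) (hJ : lie_orthogonal J) :
  (J @: radical L <= radical L)%VS.
Proof.
have [idR _ _] := radicalP L.
apply: subv_trans (@lie_centralizer_mod_derived_radical K L).
apply/subvP => _ /memv_imgP[x xR ->]; apply/lie_centralizer_modP => u uL'.
(* Membership is linear in [u], so [u = [y, z]] suffices. *)
rewrite -[[lie J x, u]](lfunE (bracket (J x))) memv_preim.
apply: (subvP _ _ uL'); apply/bracketvP => y z _ _.
rewrite -memv_preim lfunE /= -(hJ y) bracket_derivation !hJ.
by apply: memvD; [do 2!apply: (lie_ideall _ idR) | apply/idR/lie_ideall].
Qed.
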